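(* Let $T>0$, $\alpha\in(1/3,1/2]$ and let $\mathbf{W}=(W,\mathbb{W})$ be an $\alpha$-Hölder rough path on $[0,T]$ with $W$ taking values in $\mathbb{R}^n$. There is a linear map $I:D^{2\alpha}_{M^r}(\mathcal{L}(\mathbb{R}^n,\mathbb{R}^d))\to C^\alpha([0,T],\mathbb{R}^d)$ such that $I(\underline{Y})(0)=0$ for all $\underline{Y}\in D^{2\alpha}_{M^r}(\mathcal{L}(\mathbb{R}^n,\mathbb{R}^d))$ and such that the map $L$ defined by $$\forall t\in[0,T],\quad L(\underline{Y})(t):=I(\underline{Y})(t)\,\underline{1}+\langle\underline{Y}(t),\underline{1}\rangle\,\underline{W}$$ is linear and continuous from $D^{2\alpha}_{M^r}(\mathcal{L}(\mathbb{R}^n,\mathbb{R}^d))$ into $D^{2\alpha}_{M^r}(\mathbb{R}^d)$.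
   Context: For a path $Z$ write $Z_{s,t}:=Z_t-Z_s$. $C^\alpha([0,T],E)$ is the space of $\alpha$-Hölder functions. An $\alpha$-Hölder rough path is a pair $(W,\mathbb{W})$, $W:[0,T]\to\mathbb{R}^n$, $\mathbb{W}:[0,T]^2\to\mathbb{R}^n\otimes\mathbb{R}^n$, with $\mathbb{W}_{s,t}-\mathbb{W}_{s,u}-\mathbb{W}_{u,t}=W_{s,u}\otimes W_{u,t}$ for all $s,u,t$, $\sup_{s\ne t}\|W_{s,t}\|/|t-s|^\alpha<\infty$ and $\sup_{s\neq t}\|\mathbb{W}_{s,t}\|/|t-s|^{2\alpha}<\infty$. Modelled distributions of controlled rough paths. Let $\underline{1}$ be an abstract symbol of homogeneity $0$ and $\underline{W}=(\underline{W}^1,\dots,\underline{W}^n)$ abstract symbols of homogeneity $\alpha$. For a finite-dimensional normed space $E$, consider formal expressions $a\,\underline{1}+b\,\underline{W}$ with $a\in E$, $b\in\mathcal{L}(\mathbb{R}^n,E)$, where $b\,\underline{W}=\sum_i b(e_i)\underline{W}^i$; put $\|a\underline{1}+b\underline{W}\|_0=\|a\|$, $\|a\underline{1}+b\underline{W}\|_\alpha=\|b\|$ and $\langle a\underline{1}+b\underline{W},\underline{1}\rangle=a$. For $s,t\in[0,T]$ let $\Gamma_{t,s}(a\underline{1}+b\underline{W})=(a+bW_{s,t})\underline{1}+b\underline{W}$. Then $D^{2\alpha}_{M^r}(E)$ is the space of functions $\underline{Y}(t)=y_t\underline{1}+y'_t\underline{W}$, $t\in[0,T]$, such that $$\|\underline{Y}\|_{2\alpha,T}:=\sup_{s\neq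 t\in[0,T]}\ \sup_{\beta\in\{0,\alpha\}}\frac{\|\underline{Y}(t)-\Gamma_{t,s}\underline{Y}(s)\|_\beta}{|t-s|^{2\alpha-\beta}}<\infty,$$ with the norm $\|\underline{Y}\|^*_{2\alpha,T}:=\sup_{t\in[0,T]}\sup_{\beta\in\{0,\alpha\}}\|\underline{Y}(t)\|_\beta+\|\underline{Y}\|_{2\alpha,T}$. *)

(* Defs.v *)
From HB Require Import structures.
From mathcomp Require Import all_boot all_order all_algebra.
From mathcomp Require Import all_classical all_reals all_analysis.

Set Implicit Arguments.
Unset Strict Implicit.
Unset Printing Implicit Defensive.

Import Order.TTheory GRing.Theory Num.Theory.
Import numFieldNormedType.Exports.
Local Open Scope classical_set_scope.
Local Open Scope ring_scope.

(* Indexed suprema; note that sup set0 = 0. *)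
Section sup_family.
Context {R : realType} {I : Type}.
Implicit Types (A : set I) (g h : I -> R).

Lemma sup_image_ge g A i : has_ubound (g @` A) -> A i -> g i <= sup (g @` A).
Proof. by move=> gA Ai; apply: ub_le_sup => //; exists i. Qed.

Lemma sup_image_le g A (M : R) :
  0 <= M -> (forall i, A i -> g i <= M) -> sup (g @` A) <= M.
Proof.
move=> M0 gM; have [->|/set0P A0] := eqVneq (g @` A) set0.
  by rewrite sup0.
by apply: ge_sup => // _ [i Ai <-]; exact: gM.
Qed.

Lemma sup_image_ge0 g A : (forall i, 0 <= g i) -> has_ubound (g @` A) ->
  0 <= sup (g @` A).
Proof.
move=> g0 gA; have [->|/set0P[_ [i Ai _]]] := eqVneq (g @` A) set0.
  by rewrite sup0.
by rewrite (le_trans (g0 i))// sup_image_ge.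
Qed.

Lemma has_ubound_image_le g h A : (forall i, A i -> g i <= h i) ->
  has_ubound (h @` A) -> has_ubound (g @` A).
Proof.
move=> gh [M hM]; exists M => _ [i Ai <-].
by rewrite (le_trans (gh _ Ai))//; apply: hM; exists i.
Qed.

Lemma has_ubound_imageD g h A : has_ubound (g @` A) -> has_ubound (h @` A) ->
  has_ubound ((fun i => g i + h i) @` A).
Proof.
move=> [M gM] [N hN]; exists (M + N) => _ [i Ai <-].
by rewrite lerD//; [apply: gM|apply: hN]; exists i.
Qed.

Lemma has_ubound_imageZ (l : R) g A : 0 <= l -> has_ubound (g @` A) ->
  has_ubound ((fun i => l * g i) @` A).
Proof.
move=> l0 [M gM]; exists (l * M) => _ [i Ai <-].
by rewrite ler_wpM2l//; apply: gM; exists i.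
Qed.

Lemma sup_image_leD f g h A :
  (forall i, 0 <= g i) -> (forall i, 0 <= h i) ->
  has_ubound (g @` A) -> has_ubound (h @` A) ->
  (forall i, A i -> f i <= g i + h i) ->
  sup (f @` A) <= sup (g @` A) + sup (h @` A).
Proof.
move=> g0 h0 gA hA fgh; apply: sup_image_le; first by rewrite addr_ge0 ?sup_image_ge0.
by move=> i Ai; rewrite (le_trans (fgh _ Ai))// lerD// sup_image_ge.
Qed.

Lemma sup_image_leZ (l : R) f g A : 0 <= l ->
  (forall i, 0 <= g i) -> has_ubound (g @` A) ->
  (forall i, A i -> f i <= l * g i) -> sup (f @` A) <= l * sup (g @` A).
Proof.
move=> l0 g0 gA fg; apply: sup_image_le; first by rewrite mulr_ge0 ?sup_image_ge0.
by move=> i Ai; rewrite (le_trans (fg _ Ai))// ler_wpM2l// sup_image_ge.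
Qed.

End sup_family.

Lemma homogeneous_of_le {R : realType} {V : lmodType R} (N : V -> R) :
  (forall x, 0 <= N x) -> (forall l x, N (l *: x) <= `|l| * N x) ->
  forall l x, N (l *: x) = `|l| * N x.
Proof.
move=> N0 NZ l x; apply/eqP; rewrite eq_le NZ /=.
have [->|l0] := eqVneq l 0; first by rewrite normr0 mul0r.
have := NZ l^-1 (l *: x); rewrite scalerA mulVf// scale1r normfV.
by rewrite mulrC ler_pdivlMr ?normr_gt0// mulrC.
Qed.

#[short(type="normedVectType")]
HB.structure Definition NormedVector (R : numFieldType) :=
  {V of NormedModule R V & Vector R V}.
HB.instance Definition _ (R : numFieldType) (p q : nat) := Vector.on 'M[R]_(p, q).

(* L(R^n, E), as 'Hom('rV[R]_n, E), is normed by the operator norm. *)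
Section operator_norm.
Context {R : realType} {n : nat} {E : normedVectType R}.
Implicit Types f g : 'Hom('rV[R]_n, E).

Definition opnorm f : R :=
  sup ((fun x => `|f x|) @` [set x : 'rV[R]_n | `|x| <= 1]).

Lemma opnorm_has_ubound f :
  has_ubound ((fun x => `|f x|) @` [set x : 'rV[R]_n | `|x| <= 1]).
Proof.
exists (\sum_(i < n) `|f (delta_mx 0 i)|) => _ [x /= x1 <-].
rewrite {1}(row_sum_delta x) linear_sum (le_trans (ler_norm_sum _ _ _))//.
apply: ler_sum => i _; rewrite linearZ normrZ ler_piMl//.
rewrite (le_trans _ x1)// [leRHS]/Num.norm/= mx_normrE.
by apply: le_trans (le_bigmax _ _ (0, i)).
Qed.

Lemma opnorm_ge0 f : 0 <= opnorm f.
Proof. by apply: sup_image_ge0 => //; exact: opnorm_has_ubound. Qed.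

Lemma opnorm_le f (x : 'rV[R]_n) : `|f x| <= opnorm f * `|x|.
Proof.
have [->|x0] := eqVneq x 0; first by rewrite linear0 !normr0 mulr0.
rewrite -ler_pdivrMr ?normr_gt0//.
have -> : `|f x| / `|x| = `|f (`|x|^-1 *: x)|.
  by rewrite linearZ normrZ normfV normr_id mulrC.
apply: (sup_image_ge (i := `|x|^-1 *: x) (opnorm_has_ubound f)) => /=.
by rewrite normrZ normfV normr_id mulVf// normr_eq0.
Qed.

Lemma opnormD f g : opnorm (f + g) <= opnorm f + opnorm g.
Proof.
apply: sup_image_leD => //; try exact: opnorm_has_ubound.
by move=> x _; rewrite add_lfunE ler_normD.
Qed.

Lemma opnormZ (l : R) f : opnorm (l *: f) = `|l| * opnorm f.
Proof.
apply: homogeneous_of_le => [g|k g]; first exact: opnorm_ge0.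
apply: sup_image_leZ => //; first exact: opnorm_has_ubound.
by move=> x _; rewrite scale_lfunE normrZ.
Qed.

Lemma opnorm_eq0 f : opnorm f = 0 -> f = 0.
Proof.
move=> f0; apply/lfunP => x; rewrite zero_lfunE; apply/eqP.
by rewrite -normr_le0 (le_trans (opnorm_le f x))// f0 mul0r.
Qed.

HB.instance Definition _ := Lmodule_isNormed.Build R 'Hom('rV[R]_n, E)
  opnormD opnormZ opnorm_eq0.

End operator_norm.

Definition time {R : realType} (T : R) := {t : R | 0 <= t <= T}.
HB.instance Definition _ (R : realType) (T : R) := SubChoice.on (time T).

Definition offdiag {I : eqType} : set (I * I) := [set p | p.1 != p.2].

Section hoelder_quotients.
Context {R : realType} {T : R}.
Implicit Types (s t : time T) (a : R).

Definition dist s t : R := `|val t - val s|.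

(* sup_{s <> t} |A_{s,t}| / |t - s|^a < oo, for a two-parameter A *)
Definition hoelder2 {E : normedModType R} a (A : time T -> time T -> E) : Prop :=
  has_ubound ((fun p => `|A p.1 p.2| / dist p.1 p.2 `^ a) @` offdiag).

Definition incr {E : zmodType} (Z : time T -> E) s t : E := Z t - Z s.

End hoelder_quotients.

Section hoelder_space.
Context {R : realType} {T : R}.

Definition hoelder_pred a (E : normedModType R) : {pred time T -> E} :=
  [pred Z | `[< hoelder2 a (incr Z) >]].
Arguments hoelder_pred : clear implicits.

Lemma hoelder_submod_closed a E : submod_closed (hoelder_pred a E).
Proof.
split=> [|l Y Z /asboolP hY /asboolP hZ]; apply/asboolP.
  by exists 0 => _ [[s t] /= _ <-]; rewrite /incr/= subrr normr0 mul0r.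
apply: has_ubound_image_le (has_ubound_imageD (has_ubound_imageZ (normr_ge0 l) hY) hZ).
move=> [s t] _ /=; rewrite mulrA -mulrDl ler_wpM2r ?invr_ge0 ?powR_ge0//.
by rewrite -normrZ /incr/= scalerBr opprD addrACA ler_normD.
Qed.

HB.instance Definition _ (a : R) (E : normedModType R) := GRing.isSubmodClosed.Build R (time T -> E)
  (hoelder_pred a E) (hoelder_submod_closed a E).

(* C^a([0,T], E) *)
Record hoelder_space a (E : normedModType R) := HoelderSpace {
  hoelder_fun :> time T -> E;
  _ : hoelder_fun \in hoelder_pred a E }.

HB.instance Definition _ (a : R) (E : normedModType R) := [isSub of hoelder_space a E for @hoelder_fun a E].
HB.instance Definition _ (a : R) (E : normedModType R) := [Choice of hoelder_space a E by <:].
HB.instance Definition _ (a : R) (E : normedModType R) := [SubChoice_isSubLmodule of hoelder_space a E by <:].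

End hoelder_space.
Arguments hoelder_space {R} T a E.

Section bounded_paths.
Context {R : realType} {T : R}.
Implicit Types (s t : time T) (a : R).

Lemma dist_gt0 s t : s != t -> 0 < dist s t.
Proof. by move=> st; rewrite normr_gt0 subr_eq0 eq_sym. Qed.

Let far_point : 0 < T -> exists s0 s1 : time T, forall a, exists2 M, 0 <= M &
  forall t, exists s, [/\ s = s0 \/ s = s1, s != t & dist s t `^ a <= M].
Proof.
move=> T0.
have h0 : 0 <= (0 : R) <= T by rewrite lexx ltW.
have hT : 0 <= T <= T by rewrite lexx ltW.
have T2 : 0 < T / 2 by rewrite divr_gt0.
exists (exist _ 0 h0), (exist _ T hT) => a; exists ((T / 2) `^ a + T `^ a).
  by rewrite addr_ge0 ?powR_ge0.
move=> t; have /andP[t0 tT] := valP t.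
have powM d : T / 2 <= d <= T -> d `^ a <= (T / 2) `^ a + T `^ a.
  move=> /andP[Td dT]; have d0 := lt_le_trans T2 Td.
  have [a0|a0] := leP 0 a.
    rewrite (@le_trans _ _ (T `^ a)) ?lerDr ?powR_ge0//.
    by rewrite ge0_ler_powR// nnegrE ltW.
  rewrite (@le_trans _ _ ((T / 2) `^ a)) ?lerDl ?powR_ge0//.
  rewrite -[a]opprK !(powRN _ (- a)) lef_pV2 ?posrE ?powR_gt0//.
  by rewrite ge0_ler_powR// ?nnegrE ?oppr_ge0 ltW.
have [tle|tgt] := leP (val t) (T / 2).
  exists (exist _ T hT); split; first by right.
    rewrite -val_eqE/= eq_sym lt_eqF// (le_lt_trans tle)// ltr_pdivrMr//.
    by rewrite ltr_pMr// ltr1n.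
  apply: powM; rewrite /dist/= distrC ger0_norm ?subr_ge0//.
  by rewrite lerBlDr lerDl t0 andbT lerBrDr -lerBrDl {2}(splitr T) addrK.
exists (exist _ 0 h0); split; first by left.
  by rewrite -val_eqE/= lt_eqF// (lt_trans T2).
by apply: powM; rewrite /dist/= subr0 ger0_norm// (ltW tgt).
Qed.

Lemma has_ubound_path a (K : R) (g h : time T -> R) : 0 <= K ->
  (forall s t, s != t -> g t <= h s + K * dist s t `^ a) ->
  has_ubound (g @` setT).
Proof.
move=> K0 gh; have [T0|T0] := ltP 0 T.
  have [s0 [s1 /(_ a)[M M0 sM]]] := far_point T0.
  exists (`|h s0| + `|h s1| + K * M) => _ [t _ <-].
  have [s [s01 st stM]] := sM t.
  rewrite (le_trans (gh _ _ st))// lerD// ?ler_wpM2l//.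
  case: s01 => ->; rewrite (le_trans (ler_norm _))//.
    by rewrite lerDl.
  by rewrite lerDr.
have [[s0 _]|none] := pselect (exists s0 : time T, True); last first.
  by exists 0 => x [t _ _]; exfalso; apply: none; exists t.
exists (g s0) => _ [t _ <-]; suff -> : t = s0 by [].
have z (r : time T) : val r = 0.
  have /andP[r0 rT] := valP r.
  by apply/eqP; rewrite eq_le r0 (le_trans rT T0).
by apply: val_inj; rewrite !z.
Qed.

Lemma hoelder2_le {E : normedModType R} a (A : time T -> time T -> E) :
  hoelder2 a A -> exists2 K, 0 <= K &
    forall s t, s != t -> `|A s t| <= K * dist s t `^ a.
Proof.
move=> [K AK]; exists `|K| => // s t st.
rewrite -ler_pdivrMr ?powR_gt0 ?dist_gt0//.
by rewrite (le_trans _ (ler_norm K))//; apply: AK; exists (s, t).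
Qed.

Lemma hoelder_bounded {E : normedModType R} a (Z : time T -> E) :
  hoelder2 a (incr Z) -> has_ubound ((fun t => `|Z t|) @` setT).
Proof.
move=> /hoelder2_le[K K0 ZK].
apply: (@has_ubound_path a K _ (fun s => `|Z s|)) => // s t st.
by rewrite -lerBlDl (le_trans (lerB_dist _ _))// ZK.
Qed.

End bounded_paths.

(* R^n (x) R^n is identified with the n x n matrices, x (x) y being x^T y. *)
Record rough_path {R : realType} (T a : R) (n : nat) := RoughPath {
  rp_path :> time T -> 'rV[R]_n;
  rp_area : time T -> time T -> 'M[R]_n;
  rp_chen : forall s u t, rp_area s t - rp_area s u - rp_area u t =
    (incr rp_path s u)^T *m incr rp_path u t;
  rp_path_hoelder : hoelder2 a (incr rp_path);
  rp_area_hoelder : hoelder2 (2 * a) rp_area }.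

(* The formal expression y 1 + y' W is encoded as the pair (y, y'). *)
Notation expansion n E := (E * 'Hom('rV[_]_n, E))%type.

Section modelled_distributions.
Context {R : realType} {T a : R} {n : nat}.
Variables (W : rough_path T a n) (E : normedVectType R).
Implicit Types (s t : time T) (x : expansion n E) (Y : time T -> expansion n E).

Definition Gamma t s x : expansion n E := (x.1 + x.2 (incr W s t), x.2).

Definition remainder Y s t : expansion n E := Y t - Gamma t s (Y s).

(* sup over beta in {0, a} of |Y(t) - Gamma_{t,s} Y(s)|_beta / |t - s|^(2a - beta) *)
Definition modelled_quot Y (p : time T * time T) : R :=
  Num.max (`|(remainder Y p.1 p.2).1| / dist p.1 p.2 `^ (2 * a - 0))
          (`|(remainder Y p.1 p.2).2| / dist p.1 p.2 `^ (2 * a - a)).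

Definition modelled_seminorm Y : R := sup (modelled_quot Y @` offdiag).

(* sup over beta in {0, a} of |x|_beta *)
Definition expansion_norm x : R := Num.max `|x.1| `|x.2|.

Definition modelled_norm Y : R :=
  sup ((fun t => expansion_norm (Y t)) @` setT) + modelled_seminorm Y.

Definition modelled_pred : {pred time T -> expansion n E} :=
  [pred Y | `[< has_ubound (modelled_quot Y @` offdiag) >]].

Lemma remainder_lin (l : R) Y Z s t :
  remainder (l *: Y + Z) s t = l *: remainder Y s t + remainder Z s t.
Proof.
apply/eqP; rewrite xpair_eqE /=; apply/andP; split; apply/eqP.
  rewrite add_lfunE scale_lfunE scalerBr scalerDr.
  by rewrite [X in _ - X]addrACA opprD addrACA.
by rewrite scalerBr opprD addrACA.
Qed.

Lemma modelled_quot_ge0 Y p : 0 <= modelled_quot Y p.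
Proof. by rewrite le_max divr_ge0// powR_ge0. Qed.

Lemma expansion_norm_ge0 x : 0 <= expansion_norm x.
Proof. by rewrite le_max normr_ge0. Qed.

Lemma modelled_quot_lin (l : R) Y Z p :
  modelled_quot (l *: Y + Z) p <= `|l| * modelled_quot Y p + modelled_quot Z p.
Proof.
rewrite /modelled_quot remainder_lin; case: p => s t /=.
rewrite ge_max; apply/andP; split.
- apply: (@le_trans _ _ (`|l| * (`|(remainder Y s t).1| / dist s t `^ (2 * a - 0))
      + `|(remainder Z s t).1| / dist s t `^ (2 * a - 0))).
    rewrite mulrA -mulrDl ler_wpM2r ?invr_ge0 ?powR_ge0//.
    by rewrite -normrZ ler_normD.
  by rewrite lerD ?ler_wpM2l// le_max lexx.
- apply: (@le_trans _ _ (`|l| * (`|(remainder Y s t).2| / dist s t `^ (2 * a - a))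
      + `|(remainder Z s t).2| / dist s t `^ (2 * a - a))).
    rewrite mulrA -mulrDl ler_wpM2r ?invr_ge0 ?powR_ge0//.
    by rewrite -normrZ ler_normD.
  by rewrite lerD ?ler_wpM2l// le_max lexx orbT.
Qed.

Lemma modelled_submod_closed : submod_closed modelled_pred.
Proof.
split=> [|l Y Z /asboolP hY /asboolP hZ]; apply/asboolP.
  exists 0 => _ [[s t] /= _ <-]; rewrite /modelled_quot /remainder /Gamma /=.
  by rewrite zero_lfunE addr0 !subrr !normr0 !mul0r maxxx.
apply: has_ubound_image_le (has_ubound_imageD (has_ubound_imageZ (normr_ge0 l) hY) hZ).
by move=> p _; exact: modelled_quot_lin.
Qed.

HB.instance Definition _ := GRing.isSubmodClosed.Build R _
  modelled_pred modelled_submod_closed.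

(* D^{2a}_{M^r}(E), normed below by modelled_norm; the sup over t in that norm is
   finite because W is a-Hoelder. *)
Record modelled := Modelled {
  modelled_fun :> time T -> expansion n E;
  _ : modelled_fun \in modelled_pred }.

HB.instance Definition _ := [isSub of modelled for modelled_fun].
HB.instance Definition _ := [Choice of modelled by <:].
HB.instance Definition _ := [SubChoice_isSubLmodule of modelled by <:].

Lemma modelled_quot_has_ubound (Y : modelled) :
  has_ubound (modelled_quot Y @` offdiag).
Proof. by have /asboolP := valP Y. Qed.

Lemma modelled_has_ubound (Y : modelled) :
  has_ubound ((fun t => expansion_norm (Y t)) @` setT).
Proof.
have [K0 YK] : exists K, forall p, offdiag p -> modelled_quot Y p <= K.
  by have [K YK] := modelled_quot_has_ubound Y; exists K => p pd; apply: YK; exists p.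
pose K := `|K0|; have K_ge0 : 0 <= K by exact: normr_ge0.
have q1 s t : s != t -> `|(remainder Y s t).1| <= K * dist s t `^ (2 * a - 0).
  move=> st; rewrite -ler_pdivrMr ?powR_gt0 ?dist_gt0//.
  rewrite (le_trans _ (ler_norm K0))// (le_trans _ (YK (s, t) st))//.
  by rewrite le_max lexx.
have q2 s t : s != t -> `|(remainder Y s t).2| <= K * dist s t `^ (2 * a - a).
  move=> st; rewrite -ler_pdivrMr ?powR_gt0 ?dist_gt0//.
  rewrite (le_trans _ (ler_norm K0))// (le_trans _ (YK (s, t) st))//.
  by rewrite le_max lexx orbT.
have [C WC] := hoelder_bounded (rp_path_hoelder W).
have {}WC t : `|W t| <= C by apply: WC; exists t.
have b1 : has_ubound ((fun t => `|(Y t).1|) @` setT).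
  apply: (@has_ubound_path _ _ (2 * a - 0) K _
    (fun s => `|(Y s).1| + `|(Y s).2| * (C + C))) => // s t st.
  have -> : (Y t).1 = (Y s).1 + (Y s).2 (incr W s t) + (remainder Y s t).1.
    by rewrite /= addrC subrK.
  rewrite (le_trans (ler_normD _ _))// lerD ?q1//.
  rewrite (le_trans (ler_normD _ _))// lerD// (le_trans (opnorm_le _ _))//.
  apply: ler_wpM2l; first exact: opnorm_ge0.
  by rewrite /incr (le_trans (ler_normB _ _))// lerD.
have b2 : has_ubound ((fun t => `|(Y t).2|) @` setT).
  apply: (@has_ubound_path _ _ (2 * a - a) K _ (fun s => `|(Y s).2|)) => // s t st.
  by rewrite -lerBlDl (le_trans (lerB_dist _ _))// q2.
apply: has_ubound_image_le (has_ubound_imageD b1 b2) => t _.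
by rewrite ge_max lerDl lerDr !normr_ge0.
Qed.

Lemma modelled_norm_ge0 (Y : modelled) : 0 <= modelled_norm Y.
Proof.
apply: addr_ge0; apply: sup_image_ge0.
- by move=> t; exact: expansion_norm_ge0.
- exact: modelled_has_ubound.
- by move=> p; exact: modelled_quot_ge0.
- exact: modelled_quot_has_ubound.
Qed.

Lemma modelled_normD (Y Z : modelled) :
  modelled_norm (Y + Z) <= modelled_norm Y + modelled_norm Z.
Proof.
rewrite /modelled_norm addrACA lerD//.
- apply: sup_image_leD; try exact: modelled_has_ubound;
    try by move=> t; exact: expansion_norm_ge0.
  move=> t _; rewrite ge_max /=; apply/andP; split.
    by rewrite (le_trans (ler_normD _ _))// lerD// le_max lexx.
  by rewrite (le_trans (ler_normD _ _))// lerD// le_max lexx orbT.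
- apply: sup_image_leD; try exact: modelled_quot_has_ubound;
    try by move=> p; exact: modelled_quot_ge0.
  move=> p _; have := modelled_quot_lin 1 Y Z p.
  by rewrite scale1r normr1 mul1r.
Qed.

Lemma modelled_normZ (l : R) (Y : modelled) :
  modelled_norm (l *: Y) = `|l| * modelled_norm Y.
Proof.
apply: (homogeneous_of_le (N := fun Y : modelled => modelled_norm Y)).
  exact: modelled_norm_ge0.
move=> {l Y} l Y; rewrite /modelled_norm mulrDr lerD//.
- apply: sup_image_leZ; [by []| |exact: modelled_has_ubound|].
    by move=> t; exact: expansion_norm_ge0.
  by move=> t _; rewrite /expansion_norm /= !normrZ maxr_pMr.
- apply: sup_image_leZ; [by []| |exact: modelled_quot_has_ubound|].
    by move=> p; exact: modelled_quot_ge0.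
  move=> p _; have := modelled_quot_lin l Y 0 p.
  rewrite addr0 => /le_trans; apply; rewrite gerDl.
  case: p => s t; rewrite /modelled_quot /remainder /Gamma /=.
  by rewrite zero_lfunE addr0 !subrr !normr0 !mul0r maxxx.
Qed.

Lemma modelled_norm_eq0 (Y : modelled) : modelled_norm Y = 0 -> Y = 0.
Proof.
move=> Y0; apply: val_inj; apply/funext => t /=.
have : expansion_norm (Y t) <= 0.
  rewrite -Y0 -[leLHS]addr0 lerD//.
    by apply: (sup_image_ge (i := t) (modelled_has_ubound Y)).
  apply: sup_image_ge0; last exact: modelled_quot_has_ubound.
  by move=> p; exact: modelled_quot_ge0.
rewrite ge_max !normr_le0 => /andP[/eqP Y1 /eqP Y2].
by rewrite [LHS]surjective_pairing Y1 Y2.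
Qed.

HB.instance Definition _ := Lmodule_isNormed.Build R modelled
  modelled_normD modelled_normZ modelled_norm_eq0.

End modelled_distributions.

(* Main.v *)
Require Import Defs.
From HB Require Import structures.
From mathcomp Require Import all_boot all_order all_algebra.
From mathcomp Require Import all_classical all_reals all_analysis.
From mathcomp Require Import ring lra.

Set Implicit Arguments.
Unset Strict Implicit.
Unset Printing Implicit Defensive.

Import Order.TTheory GRing.Theory Num.Theory.
Import numFieldNormedType.Exports.
Local Open Scope classical_set_scope.
Local Open Scope ring_scope.

(** The map I is the rough integral of a controlled path against (W, WW), and it
    comes from the sewing of the compensated germ
      Xi_{s,t} = y_s W_{s,t} + y'_s WW_{s,t},
    where y' is contracted with the area WW.  Chen's relation gives
      Xi_{s,t} - Xi_{s,u} - Xi_{u,t} =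
        - (y_u - y_s - y'_s W_{s,u}) W_{u,t} - (y'_u - y'_s) WW_{u,t}
    (lemma [germ_defect]), and each term on the right is at most a constant times
    the norm of Y times |u - s|^b |t - u|^c with b + c = 3 alpha.  So Xi is
    additive up to an error of order 3 alpha > 1.

    The sewing lemma [sew_dist_le] turns such a germ into the increments of a
    genuine path: [sew] is the limit of the left-point Riemann sums over the
    dyadic grids of a fixed interval, and it differs from Xi_{s,t} by
    O(|t - s|^(3 alpha)).  Using one nested family of grids for all times makes the
    limit additive by construction, and makes it linear in the germ, so that the
    integral is linear in Y without a uniqueness argument.  The estimate follows
    from comparing s and t at the grid whose mesh is comparable to t - s: there
    they lie in the same or in adjacent cells, and the passage to each finer grid
    of mesh h changes the increment by O((t - s) / h) defects of size h^(3 alpha),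
    which is a geometric series because 3 alpha > 1.

    Since |WW_{s,t}| = O(|t - s|^(2 alpha)), the increment of the integral is
    y_s W_{s,t} up to O(|t - s|^(2 alpha)); this says exactly that (I(Y), y) is a
    modelled distribution.  All constants are multiples of the norm of Y
    ([rough_integral_estimates]), hence the continuity of L. *)

(** * Sequences with geometrically small steps *)

(** Joins the completeness and the norm of matrices, so that row vectors of any
    length, zero included, form a complete normed module. *)
HB.instance Definition _ (R : realType) (p q : nat) := Complete.on 'M[R]_(p, q).

Lemma series_le_geometric (R : realType) (u : R^nat) (M q : R) :
  0 < q < 1 -> (forall n, 0 <= u n <= M * q ^+ n) ->
  cvgn (series u) /\ limn (series u) <= M / (1 - q).
Proof.
move=> /andP[q0 q1] uM.
have M0 : 0 <= M by have /andP[u0 /(le_trans u0)] := uM 0%N; rewrite mulr1.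
have bd k : series u k <= M / (1 - q).
  rewrite (le_trans _ (geometric_le_lim k M0 q0 _)) ?gtr0_norm//.
  by rewrite ler_sum// => i _; have /andP[] := uM i.
have cu : cvgn (series u).
  apply: nondecreasing_is_cvgn; last by exists (M / (1 - q)) => _ [k _ <-].
  by apply: nondecreasing_series => i _ _; have /andP[] := uM i.
by split=> //; apply: limr_le => //; apply: nearW.
Qed.

Lemma limn_geometric_dist (R : realType) (E : completeNormedModType R)
    (u : E^nat) (M q : R) (N : nat) : 0 < q < 1 ->
  (forall n, (N <= n)%N -> `|u n.+1 - u n| <= M * q ^+ n) ->
  cvgn u /\ `|limn u - u N| <= M * q ^+ N / (1 - q).
Proof.
move=> q01 uM; pose v n := u (n + N)%N.
have vE n : v n = v 0%N + series (telescope v) n by exact: eq_sum_telescope.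
have [cn ln] : cvgn [normed series (telescope v)] /\
    limn [normed series (telescope v)] <= M * q ^+ N / (1 - q).
  apply: series_le_geometric => // n; rewrite normr_ge0 /telescope /v/= addSn.
  by rewrite (le_trans (uM _ _)) ?leq_addl// addnC exprD mulrA.
have cs := normed_cvg cn.
have cv : v @ \oo --> v 0%N + limn (series (telescope v)).
  apply: cvg_trans (cvgD (cvg_cst (v 0%N)) cs).
  by apply: near_eq_cvg; apply: nearW => n; exact/esym/vE.
have cu : u @ \oo --> v 0%N + limn (series (telescope v)) by rewrite -(cvg_shiftn N).
split; first by apply/cvg_ex; eexists; exact: cu.
by rewrite (cvg_lim _ cu)// /v add0n addrC addKr (le_trans (lim_series_norm _)).
Qed.

(** * The sewing lemma *)

Section sewing.
Context {R : realType} {E : completeNormedModType R}.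
Implicit Types (A : R -> R -> E) (s u t L : R) (n : nat).

Definition defect A s u t : E := A s t - A s u - A u t.

Definition mesh L n : R := L / 2 ^+ n.

Definition cell L n t : nat := Num.truncn (t / mesh L n).

(** The Riemann sum of A over the cells of the grid of mesh L / 2 ^ n that lie to
    the left of t, completed by the incomplete cell that ends at t.  It is defined
    for every t, and its increments are additive for each fixed n. *)
Definition sew_sum A L n t : E :=
  \sum_(0 <= i < cell L n t) A (i%:R * mesh L n) (i.+1%:R * mesh L n)
  + A ((cell L n t)%:R * mesh L n) t.

Definition sew A L t : E := limn (fun n => sew_sum A L n t).

Lemma mesh_gt0 L n : 0 < L -> 0 < mesh L n.
Proof. by move=> L0; rewrite divr_gt0// exprn_gt0. Qed.

Lemma meshS L n : mesh L n = 2 * mesh L n.+1.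
Proof. by rewrite /mesh exprS; field; rewrite expf_neq0//= pnatr_eq0. Qed.

Lemma mesh_le L n m : 0 < L -> (n <= m)%N -> mesh L m <= mesh L n.
Proof.
move=> L0 nm; rewrite ler_pM2l// lef_pV2 ?posrE ?exprn_gt0//.
by rewrite ler_weXn2l// ler1n.
Qed.

Lemma mesh_powR L n a : 0 < L -> mesh L n `^ a = L `^ a * (2^-1 `^ a) ^+ n.
Proof.
move=> L0; rewrite /mesh -exprVn powRM ?(ltW L0)// ?exprn_ge0 ?invr_ge0//.
congr (_ * _); rewrite -[in LHS]powR_mulrn ?invr_ge0//.
by rewrite -[RHS]powR_mulrn; [exact: powRAC|exact: powR_ge0].
Qed.

(** Every length below L is comparable to the mesh of some dyadic grid; the strict
    lower bound leaves at most one grid point between two times at distance x. *)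
Lemma mesh_window L x : 0 < x < L -> exists n, x < mesh L n <= 2 * x.
Proof.
move=> /andP[x0 xL]; have L0 := lt_trans x0 xL.
have ex : exists n, mesh L n <= x.
  exists (Num.truncn (L / x)).+1; set N := _.+1.
  rewrite /mesh ler_pdivrMr ?exprn_gt0// mulrC -ler_pdivrMr//.
  rewrite (le_trans (ltW (truncnS_gt _)))// -natrX ler_nat.
  by rewrite ltnW// ltn_expl.
case: (ex_minnP ex) => -[|n] nx nmin.
  by move: nx; rewrite /mesh expr0 divr1 leNgt xL.
exists n; rewrite (meshS L n) ler_pM2l// nx andbT -meshS ltNge.
by apply/negP => /nmin; rewrite ltnn.
Qed.

Lemma cell_bounds L n t : 0 < L -> 0 <= t ->
  (cell L n t)%:R * mesh L n <= t < (cell L n t)%:R * mesh L n + mesh L n.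
Proof.
move=> L0 t0; have h0 := mesh_gt0 n L0.
have /andP[] := truncn_itv (divr_ge0 t0 (ltW h0)).
by rewrite ler_pdivlMr// ltr_pdivrMr// -natr1 mulrDl mul1r => -> ->.
Qed.

Lemma le_cell L n s t : 0 < L -> s <= t -> (cell L n s <= cell L n t)%N.
Proof.
move=> L0 st; apply: le_truncn.
by rewrite ler_wpM2r// invr_ge0 ltW// mesh_gt0.
Qed.

Lemma cellS L n t : 0 < L -> 0 <= t ->
  cell L n.+1 t = (cell L n t).*2 \/ cell L n.+1 t = (cell L n t).*2.+1.
Proof.
move=> L0 t0; have /andP[a b] := cell_bounds n L0 t0.
have /andP[a' b'] := cell_bounds n.+1 L0 t0.
have h0 := mesh_gt0 n.+1 L0; rewrite meshS in a b.
set k := cell L n t in a b *; set k' := cell L n.+1 t in a' b' *.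
have : (k.*2 < k'.+1)%N.
  rewrite -(ltr_nat R) -(ltr_pM2r h0) -natr1 mulrDl mul1r.
  by apply: le_lt_trans b'; rewrite -muln2 natrM -mulrA.
have : (k' < k.*2.+2)%N.
  rewrite -(ltr_nat R) -(ltr_pM2r h0) (le_lt_trans a')// (lt_le_trans b)//.
  by rewrite -[k.*2.+2]addn2 natrD -(muln2 k) natrM; lra.
rewrite !ltnS leq_eqVlt => /orP[/eqP|]; first by right.
by rewrite ltnS => h1 h2; left; apply/eqP; rewrite eqn_leq h1 h2.
Qed.

Lemma sum_double (F : nat -> E) k :
  \sum_(0 <= i < k.*2) F i = \sum_(0 <= i < k) (F i.*2 + F i.*2.+1).
Proof.
elim: k => [|k IH]; first by rewrite !big_nil.
by rewrite doubleS !big_nat_recr//= IH addrA.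
Qed.

(** The grid of mesh L / 2 ^ n.+1 cuts each full cell at its midpoint, which costs
    one defect.  If t lies in the left half of its cell, the last defect has its
    first two arguments equal and is - A p p, which vanishes; this puts the two
    possible positions of t under one formula. *)
Lemma sew_sumS A L n t : 0 < L -> 0 <= t -> (forall s, A s s = 0) ->
  sew_sum A L n t - sew_sum A L n.+1 t =
  \sum_(0 <= i < cell L n t) defect A (i%:R * mesh L n)
     (i.*2.+1%:R * mesh L n.+1) (i.+1%:R * mesh L n)
  + defect A ((cell L n t)%:R * mesh L n)
     ((cell L n.+1 t)%:R * mesh L n.+1) t.
Proof.
move=> L0 t0 A0; rewrite /sew_sum; set k := cell L n t; set h := mesh L n.+1.
have dE i : i%:R * mesh L n = i.*2%:R * h.
  by rewrite meshS -muln2 natrM mulrA.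
under eq_bigr do rewrite dE (dE _.+1).
under [in RHS]eq_bigr do rewrite dE (dE _.+1).
rewrite dE.
have -> : \sum_(0 <= i < k) defect A (i.*2%:R * h) (i.*2.+1%:R * h) (i.+1.*2%:R * h)
  = \sum_(0 <= i < k) A (i.*2%:R * h) (i.+1.*2%:R * h)
    - \sum_(0 <= i < k.*2) A (i%:R * h) (i.+1%:R * h).
  by rewrite sum_double -sumrB; apply: eq_bigr => i _; rewrite /defect opprD addrA.
rewrite /defect; have [->|->] := cellS n L0 t0; rewrite -/k.
  by rewrite A0 subr0 subrr addr0 opprD addrACA subrr addr0.
by rewrite big_nat_recr//= -[X in _ - X]addrA opprD addrACA opprD !addrA.
Qed.

Section estimates.
Variables (A : R -> R -> E) (C theta L : R).
Hypothesis L0 : 0 < L.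
Hypothesis theta1 : 1 < theta.
Hypothesis C0 : 0 <= C.
(* With a common bound m on the two gaps, the hypothesis also covers triples that
   are not in increasing order, as well as repeated times. *)
Hypothesis A_defect : forall s u t (m : R), `|u - s| <= m -> `|t - u| <= m ->
  `|defect A s u t| <= C * m `^ theta.

Let rate : R := 2^-1 `^ (theta - 1).

(** The first summand collects the refinements beyond the mesh comparable to the
    increment, the second the comparison at that mesh. *)
Definition sew_const : R := 7 * 2 `^ (theta - 1) / (1 - rate) + 2 * 2 `^ theta.

Let rate_bounds : 0 < rate < 1.
Proof.
have r0 : 0 < theta - 1 by rewrite subr_gt0.
apply/andP; split; first by rewrite powR_gt0 ?invr_gt0.
have : 2^-1 `^ (theta - 1) < 1 `^ (theta - 1).
  apply: gt0_ltr_powR => //; [by rewrite nnegrE invr_ge0|by rewrite nnegrE|].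
  by rewrite invf_lt1// ltr1n.
by rewrite powR1.
Qed.

(** The defect of (s, s, s) is - A s s, and the gap bound can be taken to be 0. *)
Lemma almost_additive_diag s : A s s = 0.
Proof.
have : `|defect A s s s| <= C * 0 `^ theta by apply: A_defect; rewrite subrr normr0.
rewrite powR0 ?gt_eqF ?(lt_trans ltr01)// mulr0 normr_le0 /defect subrr sub0r.
by rewrite oppr_eq0 => /eqP.
Qed.

Lemma almost_additive_swap s t : `|A s t + A t s| <= C * `|t - s| `^ theta.
Proof.
have -> : A s t + A t s = - defect A s t s.
  by rewrite /defect almost_additive_diag sub0r opprD !opprK.
by rewrite normrN; apply: A_defect; rewrite // distrC.
Qed.

Lemma powR_split h : 0 < h -> h `^ theta = h * h `^ (theta - 1).
Proof.
by move=> h0; rewrite mulr_powRB1 ?(ltW h0)// (lt_trans ltr01).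
Qed.

(** Between s and t there are at most (t - s) / h + 1 full cells of mesh h, each
    contributing one defect, and each endpoint contributes one more.  When
    h <= 2 (t - s) this makes at most 7 (t - s) / h defects of size C h ^ theta. *)
Lemma sew_sum_step n s t : 0 <= s <= t -> mesh L n <= 2 * (t - s) ->
  `|(sew_sum A L n.+1 t - sew_sum A L n.+1 s)
    - (sew_sum A L n t - sew_sum A L n s)|
  <= 7 * C * (t - s) * mesh L n `^ (theta - 1).
Proof.
move=> /andP[s0 st] hst; have t0 := le_trans s0 st.
have h0 := mesh_gt0 n L0; have h'0 := mesh_gt0 n.+1 L0.
have hE := meshS L n.
pose d i := defect A (i%:R * mesh L n) (i.*2.+1%:R * mesh L n.+1) (i.+1%:R * mesh L n).
pose e r := defect A ((cell L n r)%:R * mesh L n) ((cell L n.+1 r)%:R * mesh L n.+1) r.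
have d_le i : `|d i| <= C * mesh L n `^ theta.
  apply: A_defect.
    have -> : i.*2.+1%:R * mesh L n.+1 - i%:R * mesh L n = mesh L n.+1 :> R.
      by rewrite hE -[i.*2.+1]addn1 natrD -(muln2 i) natrM; ring.
    by rewrite gtr0_norm// mesh_le.
  have -> : i.+1%:R * mesh L n - i.*2.+1%:R * mesh L n.+1 = mesh L n.+1 :> R.
    by rewrite hE -[i.+1]addn1 -[i.*2.+1]addn1 !natrD -(muln2 i) natrM; ring.
  by rewrite gtr0_norm// mesh_le.
have e_le r : 0 <= r -> `|e r| <= C * mesh L n `^ theta.
  move=> r0; have /andP[a b] := cell_bounds n L0 r0.
  have /andP[a' b'] := cell_bounds n.+1 L0 r0.
  have ab : (cell L n r)%:R * mesh L n <= (cell L n.+1 r)%:R * mesh L n.+1.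
    rewrite hE mulrA -natrM muln2 ler_pM2r// ler_nat.
    by have [->|->] := cellS n L0 r0.
  by apply: A_defect; rewrite ger0_norm ?subr_ge0//; lra.
have -> : (sew_sum A L n.+1 t - sew_sum A L n.+1 s)
    - (sew_sum A L n t - sew_sum A L n s)
  = - (\sum_(cell L n s <= i < cell L n t) d i + (e t - e s)).
  have := sew_sumS n L0 s0 almost_additive_diag; have := sew_sumS n L0 t0 almost_additive_diag.
  rewrite -/(e t) -/(e s) -/d (big_cat_nat _ (le_cell n L0 st))//=.
  move=> Ht Hs.
  have swap (p q x y : E) : (p - q) - (x - y) = - ((x - p) - (y - q)).
    by rewrite !opprB [LHS]addrACA [RHS]addrACA (addrC p).
  have cancel (p q x y : E) : p + q + x - (p + y) = q + (x - y).
    by rewrite -(addrA p) opprD addrACA subrr add0r addrA.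
  by rewrite swap Ht Hs cancel.
rewrite normrN.
have cnt : (cell L n t - cell L n s)%:R * mesh L n <= t - s + mesh L n.
  have /andP[a b] := cell_bounds n L0 t0; have /andP[a' b'] := cell_bounds n L0 s0.
  by rewrite natrB ?le_cell// mulrBl; lra.
apply: (@le_trans _ _ (((cell L n t - cell L n s)%:R + 2) * (C * mesh L n `^ theta))).
  rewrite mulrDl (le_trans (ler_normD _ _))// lerD//.
    rewrite (le_trans (ler_norm_sum _ _ _))//.
    rewrite (le_trans (ler_sum _ (fun i _ => d_le i)))//.
    by rewrite sumr_const_nat mulr_natl.
  by rewrite (le_trans (ler_normB _ _))// mulr2n mulrDl mul1r lerD ?e_le.
rewrite powR_split// [leLHS](_ : _ = C * mesh L n `^ (theta - 1) *
  ((cell L n t - cell L n s)%:R * mesh L n + 2 * mesh L n)); last by ring.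
rewrite [leRHS](_ : _ = C * mesh L n `^ (theta - 1) * (7 * (t - s))); last by ring.
by rewrite ler_wpM2l ?mulr_ge0 ?powR_ge0//; lra.
Qed.

(** When t - s is below the mesh, s and t lie in the same cell or in adjacent ones,
    and the difference is one defect or a difference of two. *)
Lemma sew_sum_local n s t : 0 <= s <= t -> t - s < mesh L n ->
  `|sew_sum A L n t - sew_sum A L n s - A s t| <= 2 * (C * mesh L n `^ theta).
Proof.
move=> /andP[s0 st] sth; have t0 := le_trans s0 st.
have h0 := mesh_gt0 n L0.
have /andP[a b] := cell_bounds n L0 t0; have /andP[a' b'] := cell_bounds n L0 s0.
have := le_cell n L0 st; rewrite leq_eqVlt => /orP[/eqP eqk|ltk].
  rewrite /sew_sum -eqk in a b *; set p := _%:R * _ in a b a' b' *.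
  have -> : \sum_(0 <= i < cell L n s) A (i%:R * mesh L n) (i.+1%:R * mesh L n)
    + A p t - (\sum_(0 <= i < cell L n s) A (i%:R * mesh L n) (i.+1%:R * mesh L n)
      + A p s) - A s t = defect A p s t.
    by rewrite opprD addrACA subrr add0r.
  apply: (@le_trans _ _ (C * mesh L n `^ theta)).
    by apply: A_defect; rewrite ger0_norm; lra.
  by rewrite ler_peMl ?ler1n// mulr_ge0// powR_ge0.
have kE : cell L n t = (cell L n s).+1.
  apply/eqP; rewrite eqn_leq ltk andbT -ltnS -(ltr_nat R) -(ltr_pM2r h0).
  by rewrite -[_.+2]addn2 natrD mulrDl; lra.
rewrite /sew_sum kE big_nat_recr//= in a b *.
set p' := _.+1%:R * _ in a b *; set p := _%:R * _ in a' b' *.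
have pE : p' = p + mesh L n by rewrite /p' -natr1 mulrDl mul1r.
set S := \sum_(0 <= i < _) _.
have -> : S + A p p' + A p' t - (S + A p s) - A s t = defect A p s t - defect A p p' t.
  have regroup (a0 b0 c x e : E) :
      S + a0 + b0 - (S + c) - x = (e - c - x) - (e - a0 - b0).
    rewrite -(addrA S) opprD addrACA subrr add0r -(addrA e) -(opprD c).
    by rewrite -(addrA e (- a0)) -(opprD a0) opprB [RHS]addrC subrKA opprD addrA.
  exact: regroup.
rewrite (le_trans (ler_normB _ _))// mulr2n mulrDl mul1r.
by rewrite lerD//; apply: A_defect; rewrite ger0_norm; lra.
Qed.

Lemma sew_sum0 n : sew_sum A L n 0 = 0.
Proof. by rewrite /sew_sum /cell mul0r truncn0 big_nil mul0r almost_additive_diag addr0. Qed.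

Lemma sew0 : sew A L 0 = 0.
Proof.
by rewrite /sew (_ : (fun _ => _) = fun=> 0) ?lim_cst//; apply/funext => n; exact: sew_sum0.
Qed.

(** Summing the steps of the increment from s to t, instead of those of the paths
    from 0 to s and from 0 to t, is what produces the factor t - s. *)
Let sew_incr_cvg N s t : 0 <= s <= t -> mesh L N <= 2 * (t - s) ->
  cvgn (fun n => sew_sum A L n t - sew_sum A L n s) /\
  `|limn (fun n => sew_sum A L n t - sew_sum A L n s)
    - (sew_sum A L N t - sew_sum A L N s)|
  <= 7 * C * (t - s) * mesh L N `^ (theta - 1) / (1 - rate).
Proof.
move=> s0t hN; rewrite mesh_powR// mulrA.
apply: (@limn_geometric_dist _ _ (fun n => sew_sum A L n t - sew_sum A L n s)).
  exact: rate_bounds.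
move=> n Nn; rewrite -mulrA -mesh_powR//; apply: sew_sum_step => //.
by rewrite (le_trans _ hN)// mesh_le.
Qed.

Lemma sew_cvg t : 0 <= t < L -> cvgn (fun n => sew_sum A L n t).
Proof.
move=> /andP[]; rewrite le_eqVlt => /orP[/eqP<- _|t0 tL].
  rewrite (_ : (fun _ => _) = fun=> 0); first exact: is_cvg_cst.
  by apply/funext => n; exact: sew_sum0.
have [|N /andP[_ hN]] := @mesh_window L t; first by rewrite t0.
have s0t : 0 <= (0 : R) <= t.
  by apply/andP; split=> //; exact: ltW.
have [|+ _] := @sew_incr_cvg N _ _ s0t; first by rewrite subr0.
by under [X in cvgn X]funext do rewrite sew_sum0 subr0.
Qed.

Let sew_const_ge0 : 0 <= sew_const.
Proof.
have /andP[_ r1] := rate_bounds.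
by rewrite addr_ge0 ?mulr_ge0 ?powR_ge0// invr_ge0 subr_ge0 ltW.
Qed.

Let sew_dist_lt s t : 0 <= s < L -> 0 <= t < L -> s < t ->
  `|sew A L t - sew A L s - A s t| <= sew_const * C * `|t - s| `^ theta.
Proof.
move=> sL tL st; have /andP[s0 _] := sL; have /andP[t0 tL'] := tL.
have x0 : 0 < t - s by rewrite subr_gt0.
have [|N /andP[lo hi]] := @mesh_window L (t - s).
  by rewrite x0/= (le_lt_trans _ tL')// lerBlDr lerDl.
have s0t : 0 <= s <= t by rewrite s0 ltW.
have [_ Q] := sew_incr_cvg s0t hi.
rewrite limB in Q; [|exact: sew_cvg..].
have P := sew_sum_local s0t lo.
have h0 := mesh_gt0 N L0.
have h_le a : 0 <= a -> mesh L N `^ a <= 2 `^ a * (t - s) `^ a.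
  move=> a0; rewrite -powRM ?(ltW x0)//.
  by apply: ge0_ler_powR => //; rewrite nnegrE ltW// mulr_gt0.
have -> : sew A L t - sew A L s - A s t =
    (sew A L t - sew A L s - (sew_sum A L N t - sew_sum A L N s))
    + (sew_sum A L N t - sew_sum A L N s - A s t) by rewrite addrA subrK.
rewrite (le_trans (ler_normD _ _))// (gtr0_norm x0) /sew_const !mulrDl lerD//.
  apply: le_trans Q _; rewrite (powR_split x0).
  rewrite [leRHS](_ : _ = 7 * C * (t - s) * (2 `^ (theta - 1) * (t - s) `^ (theta - 1))
    / (1 - rate)); last by ring.
  have /andP[_ r1] := rate_bounds.
  rewrite ler_wpM2r ?invr_ge0 ?subr_ge0 ?(ltW r1)// ler_wpM2l ?mulr_ge0 ?(ltW x0)//.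
  by rewrite h_le// subr_ge0 ltW.
apply: le_trans P _.
rewrite [leRHS](_ : _ = 2 * (C * (2 `^ theta * (t - s) `^ theta))); last by ring.
by rewrite !ler_wpM2l// h_le// (le_trans ler01) ?ltW.
Qed.

(** The additional 1 pays for [almost_additive_swap], which reduces the case t < s
    to the case s < t. *)
Lemma sew_dist_le s t : 0 <= s < L -> 0 <= t < L ->
  `|sew A L t - sew A L s - A s t| <= (sew_const + 1) * C * `|t - s| `^ theta.
Proof.
move=> sL tL; have [st|ts|<-] := ltgtP s t.
- by rewrite (le_trans (sew_dist_lt sL tL st))// -!mulrA ler_wpM2r ?mulr_ge0 ?powR_ge0// lerDl.
- have -> : sew A L t - sew A L s - A s t =
     - (sew A L s - sew A L t - A t s) - (A s t + A t s).
    by rewrite !opprB (addrC (A s t)) opprD addrACA subrr add0r.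
  rewrite (le_trans (ler_normB _ _))// normrN -mulrA mulrDl mul1r lerD ?almost_additive_swap//.
  by rewrite (le_trans (sew_dist_lt tL sL ts))// mulrA distrC.
- by rewrite subrr almost_additive_diag subrr normr0 !mulr_ge0 ?powR_ge0// addr_ge0.
Qed.

End estimates.

Lemma sew_lin L (l : R) A B t :
  cvgn (fun n => sew_sum A L n t) -> cvgn (fun n => sew_sum B L n t) ->
  sew (fun s u => l *: A s u + B s u) L t = l *: sew A L t + sew B L t.
Proof.
move=> cA cB; rewrite /sew -limZl_tmp// -limD//; last exact: is_cvgZl_tmp.
congr (limn _); apply/funext => n /=; rewrite /sew_sum big_split/= -scaler_sumr.
by rewrite scalerDr addrACA.
Qed.

End sewing.

(** * Linear maps *)

Lemma bundle_linear (R : pzRingType) (U V : lmodType R) (f : U -> V) :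
  linear f -> exists g : {linear U -> V}, forall x, g x = f x.
Proof.
move=> lf; pose m := GRing.isLinear.Build R U V *:%R f lf.
by exists (HB.pack f m : {linear U -> V}).
Qed.

Lemma bounded_linear_continuous (R : realType) (U V : normedModType R)
    (f : {linear U -> V}) (C : R) :
  (forall x, `|f x| <= C * `|x|) -> continuous f.
Proof.
move=> fC; apply/linear_bounded_continuous/linear_boundedP.
by near=> r => x; rewrite (le_trans (fC x))// ler_wpM2r.
Unshelve. all: by end_near. Qed.

(** * Contraction of a bilinear map with a tensor *)

Section contraction.
Context {R : realType} {n : nat} {E : normedVectType R}.
Implicit Types f g : 'Hom('rV[R]_n, 'Hom('rV[R]_n, E)).

(** The linear map on R^n (x) R^n induced by f, in the coordinates in which
    x (x) y is the matrix x^T y. *)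
Definition contract f (M : 'M[R]_n) : E :=
  \sum_(i < n) \sum_(j < n) M i j *: f (delta_mx 0 i) (delta_mx 0 j).

Lemma contractDr f : {morph contract f : M N / M + N}.
Proof.
move=> M N; rewrite /contract -big_split; apply: eq_bigr => i _ /=.
by rewrite -big_split; apply: eq_bigr => j _; rewrite mxE scalerDl.
Qed.

Lemma contract_linl (l : R) f g M :
  contract (l *: f + g) M = l *: contract f M + contract g M.
Proof.
rewrite /contract scaler_sumr -big_split; apply: eq_bigr => i _ /=.
rewrite scaler_sumr -big_split; apply: eq_bigr => j _ /=.
by rewrite !add_lfunE !scale_lfunE scalerDr !scalerA mulrC.
Qed.

Lemma contract_tensor f (x y : 'rV[R]_n) : contract f (x^T *m y) = f x y.
Proof.
rewrite {2}(row_sum_delta x) linear_sum sum_lfunE; apply: eq_bigr => i _.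
rewrite linearZ scale_lfunE {2}(row_sum_delta y) linear_sum scaler_sumr.
apply: eq_bigr => j _; rewrite linearZ scalerA; congr (_ *: _).
by rewrite mxE big_ord1 mxE.
Qed.

Lemma norm_delta_mx_le1 (i : 'I_n) : `|delta_mx 0 i : 'rV[R]_n| <= 1.
Proof.
rewrite [leLHS]/Num.norm/= mx_normrE; apply: bigmax_le => // -[a b] _ /=.
by rewrite mxE; case: (_ && _); rewrite ?normr1 ?normr0.
Qed.

Lemma contract_le f M : `|contract f M| <= n%:R ^+ 2 * `|f| * `|M|.
Proof.
have le1 i j : `|M i j *: f (delta_mx 0 i) (delta_mx 0 j)| <= `|f| * `|M|.
  rewrite normrZ mulrC ler_pM//.
    rewrite (le_trans (opnorm_le _ _))// (le_trans (ler_piMr _ (norm_delta_mx_le1 j)))//.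
      exact: opnorm_ge0.
    rewrite (le_trans (opnorm_le f _))// (le_trans (ler_piMr _ (norm_delta_mx_le1 i)))//.
    exact: opnorm_ge0.
  by rewrite [leRHS]/Num.norm/= mx_normrE; apply: le_trans (le_bigmax _ _ (i, j)).
rewrite (le_trans (ler_norm_sum _ _ _))//.
rewrite (le_trans (ler_sum _ (fun i _ => ler_norm_sum _ _ _)))//.
rewrite (le_trans (ler_sum _ (fun i _ => ler_sum _ (fun j _ => le1 i j))))//.
by rewrite !sumr_const !card_ord -mulrnA -[leLHS]mulr_natl natrM -expr2 mulrA.
Qed.

End contraction.

(** * Time and two-parameter functions *)

Section clamp.
Context {R : realType} {T : R}.
Hypothesis T0 : 0 < T.

Lemma clamp_subproof (t : R) : 0 <= Num.min (Num.max t 0) T <= T.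
Proof. by rewrite le_min le_max lexx orbT (ltW T0) ge_min lexx orbT. Qed.

(** The retraction of the line onto [0, T].  It does not increase distances, so a
    germ on [0, T] extends to the line with the same bound on its defects. *)
Definition clamp (t : R) : time T := exist (fun r : R => 0 <= r <= T) _ (clamp_subproof t).

Lemma clampK (t : time T) : clamp (val t) = t.
Proof.
have /andP[t0 tT] := valP t.
by apply: val_inj; rewrite /= max_l// min_l.
Qed.

Lemma dist_clamp_le (s t : R) : dist (clamp s) (clamp t) <= `|t - s|.
Proof.
have T_gt0 := T0.
have clamp_cases (r : R) : [\/ r <= 0 /\ val (clamp r) = 0,
    T <= r /\ val (clamp r) = T | 0 <= r /\ r <= T /\ val (clamp r) = r].
  have [r0|r0] := leP r 0; first by apply: Or31; rewrite /= max_r// min_l ?(ltW T0).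
  rewrite /= max_l ?(ltW r0)//; have [rT|rT] := leP r T.
    by apply: Or33.
  by apply: Or32; split=> //; exact: ltW.
rewrite /dist; have := ler_norm (t - s); have := ler_norm (- (t - s)).
rewrite normrN => h1 h2; rewrite ler_norml.
case: (clamp_cases s) => [[hs ->]|[hs ->]|[hs [hs' ->]]];
case: (clamp_cases t) => [[ht ->]|[ht ->]|[ht [ht' ->]]];
by apply/andP; split; lra.
Qed.

End clamp.

Section two_parameter.
Context {R : realType} {T : R}.

Lemma dist_ge0 (s t : time T) : 0 <= dist s t.
Proof. exact: normr_ge0. Qed.

Lemma dist_le (s t : time T) : dist s t <= T.
Proof.
have /andP[? ?] := valP s; have /andP[? ?] := valP t.
by rewrite /dist ler_norml; apply/andP; split; lra.
Qed.

Lemma dist_powRD_le (a b : R) (s t : time T) : 0 <= T -> 0 < a -> 0 <= b ->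
  dist s t `^ (a + b) <= T `^ b * dist s t `^ a.
Proof.
move=> T0 a0 b0; rewrite powRD; last first.
  by rewrite gt_eqF// ltr_wpDr.
rewrite mulrC ler_wpM2r ?powR_ge0//.
by apply: ge0_ler_powR; rewrite ?nnegrE ?dist_ge0 ?dist_le.
Qed.

(** The Hoelder condition constrains distinct times only; vanishing on the diagonal
    extends its bound to all pairs. *)
Lemma hoelder2_bound {E : normedModType R} (a : R) (A : time T -> time T -> E) :
  (forall s, A s s = 0) -> Defs.hoelder2 a A ->
  exists2 K, 0 <= K & forall s t, `|A s t| <= K * dist s t `^ a.
Proof.
move=> A0 /hoelder2_le[K K0 AK]; exists K => // s t.
have [->|] := eqVneq s t; last exact: AK.
by rewrite A0 normr0 mulr_ge0// powR_ge0.
Qed.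

End two_parameter.

(** * Bounds for modelled distributions *)

Section modelled_bounds.
Context {R : realType} {T a : R} {n : nat} {W : rough_path T a n}.
Context {E : normedVectType R}.
Implicit Types (Y : modelled W E) (s t : time T).

Lemma modelled_value_le Y t : expansion_norm (Y t) <= `|Y|.
Proof.
apply: (@le_trans _ _ (sup ((fun t => expansion_norm (Y t)) @` setT))).
  exact: (sup_image_ge (modelled_has_ubound Y)).
rewrite lerDl; apply: sup_image_ge0 (modelled_quot_has_ubound Y).
exact: modelled_quot_ge0.
Qed.

Lemma modelled_quot_le Y p : offdiag p -> modelled_quot W Y p <= `|Y|.
Proof.
move=> offp; apply: (@le_trans _ _ (modelled_seminorm W Y)).
  exact: (sup_image_ge (modelled_quot_has_ubound Y)).
rewrite lerDr; apply: sup_image_ge0 (modelled_has_ubound Y).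
by move=> t; exact: expansion_norm_ge0.
Qed.

Lemma modelled_remainder_le Y s t :
  `|(remainder W Y s t).1| <= `|Y| * dist s t `^ (2 * a) /\
  `|(remainder W Y s t).2| <= `|Y| * dist s t `^ a.
Proof.
have [->|st] := eqVneq s t.
  rewrite /remainder /Gamma /= /incr subrr linear0 addr0 !subrr !normr0.
  by rewrite !mulr_ge0 ?powR_ge0.
have := modelled_quot_le Y (p := (s, t)) st.
rewrite ge_max /= !ler_pdivrMr ?powR_gt0 ?dist_gt0// subr0.
by rewrite (_ : 2 * a - a = a); [move/andP|ring].
Qed.

Lemma modelled_norm_le Y (B D : R) : 0 <= B -> 0 <= D ->
  (forall t, `|(Y t).1| <= B) -> (forall t, `|(Y t).2| <= B) ->
  (forall s t, `|(remainder W Y s t).1| <= D * dist s t `^ (2 * a)) ->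
  (forall s t, `|(remainder W Y s t).2| <= D * dist s t `^ a) ->
  `|Y| <= B + D.
Proof.
move=> B0 D0 Y1 Y2 r1 r2; rewrite [leLHS]/Num.norm/= lerD//.
  by apply: sup_image_le => // t _; rewrite ge_max Y1 Y2.
apply: sup_image_le => // -[s t] st; rewrite ge_max /=.
rewrite !ler_pdivrMr ?powR_gt0 ?dist_gt0// subr0 (_ : 2 * a - a = a); last by ring.
by rewrite r1 r2.
Qed.

Lemma modelled_predP (Y : time T -> expansion n E) (D : R) :
  (forall s t, `|(remainder W Y s t).1| <= D * dist s t `^ (2 * a)) ->
  (forall s t, `|(remainder W Y s t).2| <= D * dist s t `^ a) ->
  Y \in @modelled_pred R T a n W E.
Proof.
move=> r1 r2; apply/asboolP; exists D => _ [[s t] st <-]; rewrite ge_max /=.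
rewrite !ler_pdivrMr ?powR_gt0 ?dist_gt0// subr0 (_ : 2 * a - a = a); last by ring.
by rewrite r1 r2.
Qed.

End modelled_bounds.

(** * The compensated germ *)

Section germ.
Context {R : realType} {T a : R} {n : nat} (W : rough_path T a n).
Context {E : normedVectType R}.
Implicit Types (Y Z : time T -> expansion n 'Hom('rV[R]_n, E)) (s u t : time T).

Lemma rp_area_diag s : rp_area W s s = 0.
Proof.
have := rp_chen W s s s; rewrite /incr subrr mulmx0 subrr sub0r.
by move/eqP; rewrite oppr_eq0 => /eqP.
Qed.

Definition germ Y s t : E :=
  (Y s).1 (incr W s t) + contract (Y s).2 (rp_area W s t).

Lemma germ_lin (l : R) Y Z s t :
  germ (l *: Y + Z) s t = l *: germ Y s t + germ Z s t.
Proof. by rewrite /germ /= add_lfunE scale_lfunE contract_linl scalerDr addrACA. Qed.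

(** Chen's relation contributes y'_s (W_{s,u} (x) W_{u,t}), which completes
    y_u - y_s to the remainder of Y. *)
Lemma germ_defect Y s u t : germ Y s t - germ Y s u - germ Y u t =
  - ((remainder W Y s u).1 (incr W u t) + contract (remainder W Y s u).2 (rp_area W u t)).
Proof.
have WE : incr W s t = incr W s u + incr W u t by rewrite /incr [RHS]addrC subrKA.
have AE : rp_area W s t = rp_area W s u + (rp_area W u t + (incr W s u)^T *m incr W u t).
  by rewrite -rp_chen [X in _ + X]addrC subrK addrC subrK.
have cB f g M : contract (f - g) M = contract f M - contract g M :> E.
  by rewrite addrC -scaleN1r contract_linl scaleN1r addrC.
rewrite /germ WE AE /remainder /Gamma /= linearD !contractDr contract_tensor cB.
rewrite add_lfunE opp_lfunE add_lfunE.
have cancel (p q r z c1 c2 c3 : E) :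
    p + q + (c1 + (c2 + z)) - (p + c1) - (r + c3) = - (r - (q + z) + (c3 - c2)).
  rewrite addrACA (addrC (p + c1)) addrK (opprD (r - _)) !opprB opprD.
  by rewrite (addrC c2) addrA addrACA.
exact: cancel.
Qed.

End germ.

Lemma mulrD2l (R : comPzRingType) (p q x y : R) :
  (p + q) * x * y = p * x * y + q * x * y.
Proof. by rewrite !mulrDl. Qed.

(** * The rough integral *)

Section integration.
Context {R : realType} {T a : R} {n d : nat}.
Variable W : rough_path T a n.
Hypothesis T0 : 0 < T.
Hypothesis a_bounds : 1 / 3 < a <= 1 / 2.
Local Notation E := 'rV[R]_d.
Local Notation F := 'Hom('rV[R]_n, E).
Implicit Types (Y Z : modelled W F) (s t : time T).

Let a0 : 0 < a. Proof. by have /andP[h _] := a_bounds; lra. Qed.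

Definition clamped_germ Y (s t : R) : E := germ W Y (clamp T0 s) (clamp T0 t).

Lemma germ_defect_bound : exists2 C, 0 <= C & forall Y (s u t m : R),
  `|u - s| <= m -> `|t - u| <= m ->
  `|defect (clamped_germ Y) s u t| <= C * `|Y| * m `^ (3 * a).
Proof.
have [|K1 K10 WK] := hoelder2_bound _ (rp_path_hoelder W).
  by move=> s; rewrite /incr subrr.
have [K2 K20 AK] := hoelder2_bound (rp_area_diag W) (rp_area_hoelder W).
exists (K1 + n%:R ^+ 2 * K2); first by rewrite addr_ge0 ?mulr_ge0 ?exprn_ge0.
move=> Y s u t m su ut; rewrite /defect /clamped_germ.
set cs := clamp T0 s; set cu := clamp T0 u; set ct := clamp T0 t.
have m0 : 0 <= m := le_trans (normr_ge0 _) su.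
have dpow (b : R) (x y : R) : 0 <= b -> `|y - x| <= m ->
    dist (clamp T0 x) (clamp T0 y) `^ b <= m `^ b.
  move=> b0 xy; apply: ge0_ler_powR; rewrite ?nnegrE ?dist_ge0//.
  exact: le_trans (dist_clamp_le _ _ _) xy.
have mD b c : 0 < b -> 0 < c -> m `^ (b + c) = m `^ b * m `^ c.
  by move=> b0 c0; rewrite powRD// gt_eqF// addr_gt0.
have [r1 r2] := modelled_remainder_le Y cs cu.
rewrite germ_defect normrN (le_trans (ler_normD _ _))// mulrD2l lerD//.
  rewrite (le_trans (opnorm_le _ _))// (_ : 3 * a = 2 * a + a); last by ring.
  rewrite mD ?mulr_gt0// [leRHS](_ : _ = (`|Y| * m `^ (2 * a)) * (K1 * m `^ a)); last by ring.
  rewrite ler_pM ?opnorm_ge0//.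
    by apply: le_trans r1 _; rewrite ler_wpM2l// dpow// mulr_ge0// ltW.
  by apply: le_trans (WK _ _) _; rewrite ler_wpM2l// dpow// ltW.
rewrite (le_trans (contract_le _ _))// (_ : 3 * a = a + 2 * a); last by ring.
rewrite mD ?mulr_gt0//.
rewrite [leRHS](_ : _ = n%:R ^+ 2 * ((`|Y| * m `^ a) * (K2 * m `^ (2 * a)))); last by ring.
rewrite -mulrA ler_wpM2l ?exprn_ge0// ler_pM//.
  by apply: le_trans r2 _; rewrite ler_wpM2l// dpow// ltW.
by apply: le_trans (AK _ _) _; rewrite ler_wpM2l// dpow// mulr_ge0// ltW.
Qed.

(** Any interval length above T would serve in [sew]; 2 * T keeps the endpoint T
    strictly inside. *)
Definition rough_integral Y (t : time T) : E := sew (clamped_germ Y) (2 * T) (val t).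

Let time_lt (t : time T) : 0 <= val t < 2 * T.
Proof. by have /andP[t0 tT] := valP t; rewrite t0 (le_lt_trans tT)// ltr_pMl// ltr1n. Qed.

Let theta1 : 1 < 3 * a. Proof. by have /andP[h _] := a_bounds; lra. Qed.

Let L0 : 0 < 2 * T. Proof. by rewrite mulr_gt0. Qed.

Lemma rough_integral0 Y t : val t = 0 -> rough_integral Y t = 0.
Proof.
move=> t0; have [C C0 hC] := germ_defect_bound.
by rewrite /rough_integral t0 (sew0 _ theta1 (hC Y)).
Qed.

Lemma rough_integral_lin (l : R) Y Z t :
  rough_integral (l *: Y + Z) t = l *: rough_integral Y t + rough_integral Z t.
Proof.
have [C C0 hC] := germ_defect_bound.
have cv V : cvgn (fun k => sew_sum (clamped_germ V) (2 * T) k (val t)).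
  by apply: (sew_cvg L0 theta1 _ (hC V)) => //; rewrite mulr_ge0.
rewrite /rough_integral -(sew_lin l (cv Y) (cv Z)); congr (sew _ _ _).
by apply/funext => s; apply/funext => u; exact: germ_lin.
Qed.

Lemma rough_integral_bound : exists2 C, 0 <= C & forall Y s t,
  `|rough_integral Y t - rough_integral Y s - germ W Y s t| <= C * `|Y| * dist s t `^ (3 * a).
Proof.
have [C C0 hC] := germ_defect_bound.
exists (Num.max 0 ((sew_const (3 * a) + 1) * C)) => [|Y s t]; first by rewrite le_max lexx.
have := @sew_dist_le _ _ (clamped_germ Y) (C * `|Y|) (3 * a) (2 * T) L0 theta1 _
  (hC Y) _ _ (time_lt s) (time_lt t).
rewrite /clamped_germ !clampK => H; apply: le_trans (H _) _; first by rewrite mulr_ge0.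
by rewrite mulrA !ler_wpM2r ?powR_ge0// le_max lexx orbT.
Qed.

(** The sewing error has order 3 * a and the area term order 2 * a, so the first
    bound has order 2 * a.  Since distances are at most T, an excess of order a
    costs a factor T `^ a; this reduces each estimate to the order it claims. *)
Lemma rough_integral_estimates : exists2 C, 0 <= C & forall Y,
  [/\ forall s t, `|rough_integral Y t - rough_integral Y s - (Y s).1 (incr W s t)|
        <= C * `|Y| * dist s t `^ (2 * a),
      forall s t, `|rough_integral Y t - rough_integral Y s| <= C * `|Y| * dist s t `^ a,
      forall t, `|rough_integral Y t| <= C * `|Y| &
      forall s t, `|(Y t).1 - (Y s).1| <= C * `|Y| * dist s t `^ a].
Proof.
have [|K1 K10 WK] := hoelder2_bound _ (rp_path_hoelder W).
  by move=> s; rewrite /incr subrr.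
have [K2 K20 AK] := hoelder2_bound (rp_area_diag W) (rp_area_hoelder W).
have [C C0 IC] := rough_integral_bound.
have Ta_ge0 : 0 <= T `^ a by exact: powR_ge0.
have dpow (b : R) (s t : time T) : 0 < b -> dist s t `^ (b + a) <= T `^ a * dist s t `^ b.
  by move=> b0; apply: dist_powRD_le => //; exact: ltW.
have v1 Y t : `|(Y t).1| <= `|Y|.
  by rewrite (le_trans _ (modelled_value_le Y t))// le_max lexx.
have v2 Y t : `|(Y t).2| <= `|Y|.
  by rewrite (le_trans _ (modelled_value_le Y t))// le_max lexx orbT.
pose C1 := C * T `^ a + n%:R ^+ 2 * K2.
have C10 : 0 <= C1 by rewrite addr_ge0 ?mulr_ge0 ?exprn_ge0.
have e1 Y s t : `|rough_integral Y t - rough_integral Y s - (Y s).1 (incr W s t)|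
    <= C1 * `|Y| * dist s t `^ (2 * a).
  have -> : rough_integral Y t - rough_integral Y s - (Y s).1 (incr W s t) =
      (rough_integral Y t - rough_integral Y s - germ W Y s t) + contract (Y s).2 (rp_area W s t).
    by rewrite /germ opprD addrA subrK.
  rewrite (le_trans (ler_normD _ _))// /C1 mulrD2l lerD//.
    apply: le_trans (IC _ _ _) _; rewrite (_ : 3 * a = 2 * a + a); last by ring.
    rewrite [leRHS](_ : _ = C * `|Y| * (T `^ a * dist s t `^ (2 * a))); last by ring.
    by rewrite ler_wpM2l ?mulr_ge0// dpow// mulr_gt0.
  apply: le_trans (contract_le _ _) _.
  rewrite [leRHS](_ : _ = n%:R ^+ 2 * `|Y| * (K2 * dist s t `^ (2 * a))); last by ring.
  by rewrite ler_pM ?mulr_ge0 ?exprn_ge0// ler_wpM2l ?exprn_ge0.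
have y1 Y s t : `|(Y s).1 (incr W s t)| <= K1 * `|Y| * dist s t `^ a.
  rewrite (le_trans (opnorm_le _ _))//.
  rewrite [leRHS](_ : _ = `|Y| * (K1 * dist s t `^ a)); last by ring.
  by rewrite ler_pM ?opnorm_ge0//; exact: v1.
pose C2 := C1 * T `^ a + K1.
have C20 : 0 <= C2 by rewrite addr_ge0 ?mulr_ge0.
have e2 Y s t : `|rough_integral Y t - rough_integral Y s| <= C2 * `|Y| * dist s t `^ a.
  rewrite -(subrK ((Y s).1 (incr W s t)) (rough_integral Y t - rough_integral Y s)).
  rewrite (le_trans (ler_normD _ _))// /C2 mulrD2l lerD//.
  apply: le_trans (e1 _ _ _) _; rewrite (_ : 2 * a = a + a); last by ring.
  rewrite [leRHS](_ : _ = C1 * `|Y| * (T `^ a * dist s t `^ a)); last by ring.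
  by rewrite ler_wpM2l ?mulr_ge0// dpow.
have e3 Y t : `|rough_integral Y t| <= C2 * T `^ a * `|Y|.
  have I0 : rough_integral Y (clamp T0 0) = 0.
    by apply: rough_integral0; rewrite /= maxxx min_l// ltW.
  have := e2 Y (clamp T0 0) t; rewrite I0 subr0 => /le_trans; apply.
  rewrite mulrAC ler_wpM2r// ler_wpM2l//.
  by apply: ge0_ler_powR; rewrite ?nnegrE ?dist_ge0 ?dist_le// ltW.
have e4 Y s t : `|(Y t).1 - (Y s).1| <= (T `^ a + K1) * `|Y| * dist s t `^ a.
  have -> : (Y t).1 - (Y s).1 = (remainder W Y s t).1 + (Y s).2 (incr W s t).
    by rewrite /= opprD addrA subrK.
  have [r1 _] := modelled_remainder_le Y s t.
  rewrite (le_trans (ler_normD _ _))// mulrD2l lerD//.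
    apply: le_trans r1 _; rewrite (_ : 2 * a = a + a); last by ring.
    rewrite [leRHS](_ : _ = `|Y| * (T `^ a * dist s t `^ a)); last by ring.
    by rewrite ler_wpM2l// dpow.
  rewrite (le_trans (opnorm_le _ _))//.
  rewrite [leRHS](_ : _ = `|Y| * (K1 * dist s t `^ a)); last by ring.
  by rewrite ler_pM ?opnorm_ge0//; exact: v2.
have wk (c1 c2 : R) Y (x : R) : 0 <= x -> c1 <= c2 -> c1 * `|Y| * x <= c2 * `|Y| * x.
  by move=> x0 c12; rewrite !ler_wpM2r.
exists (C1 + C2 + C2 * T `^ a + (T `^ a + K1)); first by rewrite !addr_ge0 ?mulr_ge0.
have C2T : 0 <= C2 * T `^ a by rewrite mulr_ge0.
move=> Y; split=> [s t|s t|t|s t].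
- by apply: le_trans (e1 _ _ _) _; rewrite wk ?powR_ge0//; lra.
- by apply: le_trans (e2 _ _ _) _; rewrite wk ?powR_ge0//; lra.
- by apply: le_trans (e3 _ _) _; rewrite ler_wpM2r//; lra.
- by apply: le_trans (e4 _ _ _) _; rewrite wk ?powR_ge0//; lra.
Qed.

Lemma rough_integral_hoelder Y : rough_integral Y \in @hoelder_pred R T a E.
Proof.
have [C C0 /(_ Y)[_ H _ _]] := rough_integral_estimates.
apply/asboolP; exists (C * `|Y|) => _ [[s t] st <-] /=.
by rewrite ler_pdivrMr ?powR_gt0 ?dist_gt0//; exact: H.
Qed.

Definition lifted_path Y t : expansion n E := (rough_integral Y t, (Y t).1).

Lemma lifted_path_modelled Y : lifted_path Y \in @modelled_pred R T a n W E.
Proof.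
have [C C0 /(_ Y)[H1 _ _ H4]] := rough_integral_estimates.
apply: (@modelled_predP _ _ _ _ _ _ (lifted_path Y) (C * `|Y|)) => s t; last exact: H4.
by rewrite /= opprD addrA; exact: H1.
Qed.

Definition rough_integral_map Y : hoelder_space T a E := HoelderSpace (rough_integral_hoelder Y).

Definition lifted_map Y : modelled W E := Modelled (lifted_path_modelled Y).

Lemma rough_integral_map_linear : linear rough_integral_map.
Proof. by move=> l Y Z; apply: val_inj; apply/funext => t; exact: rough_integral_lin. Qed.

Lemma lifted_map_linear : linear lifted_map.
Proof.
move=> l Y Z; apply: val_inj; apply/funext => t.
by rewrite /= /lifted_path rough_integral_lin.
Qed.

Lemma lifted_map_bounded : exists C, forall Y, `|lifted_map Y| <= C * `|Y|.
Proof.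
have [C C0 H] := rough_integral_estimates; exists ((C + 1) + C) => Y.
have [H1 _ H3 H4] := H Y; rewrite mulrDl.
have CY : 0 <= C * `|Y| by rewrite mulr_ge0.
apply: modelled_norm_le => //.
- by rewrite mulr_ge0// addr_ge0.
- by move=> t; rewrite (le_trans (H3 t))// ler_wpM2r// lerDl.
- move=> t; rewrite (@le_trans _ _ `|Y|)//.
    by rewrite (le_trans _ (modelled_value_le Y t))// le_max lexx.
  by rewrite mulrDl mul1r lerDr.
- by move=> s t; rewrite /= opprD addrA; exact: H1.
Qed.

End integration.

Theorem theorem7p3 (R : realType) (n d : nat) (T : R) (hT : 0 < T)
    (alpha : R) (halpha : 1 / 3 < alpha <= 1 / 2)
    (W : rough_path T alpha n) :
  exists I : {linear modelled W 'Hom('rV[R]_n, 'rV[R]_d) ->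
                     hoelder_space T alpha 'rV[R]_d},
    (forall Y (t : time T), val t = 0 -> I Y t = 0) /\
    exists L : {linear modelled W 'Hom('rV[R]_n, 'rV[R]_d) ->
                       modelled W 'rV[R]_d},
      (forall Y (t : time T), L Y t = (I Y t, (Y t).1)) /\
      continuous L.
Proof.
have [I IE] := bundle_linear (@rough_integral_map_linear _ _ _ _ d W hT halpha).
have [L LE] := bundle_linear (@lifted_map_linear _ _ _ _ d W hT halpha).
exists I; split=> [Y t t0|]; first by rewrite IE; exact: rough_integral0.
exists L; split=> [Y t|]; first by rewrite LE IE.
have [C LC] := @lifted_map_bounded _ _ _ _ d W hT halpha.
by apply: (bounded_linear_continuous (C := C)) => Y; rewrite LE; exact: LC.
Qed.
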